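(* Let $F\in SL(d,\mathbb{Z})$ be partially hyperbolic with invariant splitting $\mathbb{R}^d=S\oplus C\oplus U$, $\dim C=c$, and Katznelson irreducible ($C\cap\mathbb{Z}^d=\{0\}$). For $v\in\mathbb{R}^d$ let $v^c\in C$ be its projection to $C$ along $S\oplus U$, and order the standard basis $e_1,\dots,e_d$ of $\mathbb{R}^d$ so that $e_1^c,\dots,e_c^c$ is a basis of $C$. Identify $C$ with $\mathbb{R}^c$ via $e_i^c\mapsto e_i$ ($i\le c$), and let $P:\mathbb{R}^d\to\mathbb{R}^c$ be the resulting linear projection (so $Pe_i=e_i$ for $i=1,\dots,c$). Then there is $K>0$ such that for every $q\in\mathbb{Z}^c\setminus\{0\}$ there exists $i\in\{1,\dots,d\}$ with $$|Pe_i\cdot q-p|>\frac{K}{|q|^{c}}\quad\text{for all }p\in\mathbb{Z}.$$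
   Context: Partial hyperbolicity of $F$: for some metric, $\|F|_S\|<1$, $m(F|_U)>1$, $\|F|_S\|<m(F|_C)$, $m(F|_U)>\|F|_C\|$ ($m$ = conorm). Here $\cdot$ is the standard inner product on $\mathbb{R}^c$ and $|q|$ the Euclidean norm. *)

(* Defs.v *)
(* Vectors of R^d are row vectors 'rV[R]_d; subspaces of R^d
   are represented (mxalgebra style) by the row spaces of d x d matrices.
   A column-vector map x |-> F x corresponds on rows to v |-> v *m F^T. *)
From HB Require Import structures.
From mathcomp Require Import all_boot all_order all_algebra.
From mathcomp Require Import reals.
Set Implicit Arguments. Unset Strict Implicit. Unset Printing Implicit Defensive.
Import Order.TTheory GRing.Theory Num.Theory.
Local Open Scope ring_scope.

Definition mxR (R : realType) d (F : 'M[int]_d) : 'M[R]_d :=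
  map_mx (fun z : int => z%:~R) F.

Definition act (R : realType) d (F : 'M[int]_d) (v : 'rV[R]_d) : 'rV[R]_d :=
  v *m (mxR R F)^T.

Definition qform (R : realType) d (G : 'M[R]_d) (v : 'rV[R]_d) : R :=
  (v *m G *m v^T) 0 0.

Definition inner_product_mx (R : realType) d (G : 'M[R]_d) : Prop :=
  G^T = G /\ forall v : 'rV[R]_d, v != 0 -> 0 < qform G v.

Definition invariant (R : realType) d (F : 'M[int]_d) (V : 'M[R]_d) : Prop :=
  (V *m (mxR R F)^T <= V)%MS.

(* Partial hyperbolicity w.r.t. the splitting S (+) C (+) U, for some metric.
   The operator norm ||F|_V|| and conorm m(F|_V) (sup/inf of |Fv| over unit
   v in V, attained by compactness) are encoded by explicit bounds:
   ||F|_V|| <= l  iff  |Fv| <= l |v| on V,  and  m <= m(F|_V) iff m|v| <= |Fv|.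
   ls ~ ||F|_S||, mc ~ m(F|_C), lc ~ ||F|_C||, mu ~ m(F|_U).  (Squared norms.) *)
Definition partially_hyperbolic (R : realType) d (F : 'M[int]_d)
    (S C U : 'M[R]_d) : Prop :=
  [/\ [/\ invariant F S, invariant F C & invariant F U],
      mxdirect (S + C + U), (S + C + U :=: 1%:M)%MS &
  exists G : 'M[R]_d, inner_product_mx G /\
  exists ls lc mc mu : R,
    [/\ [/\ 0 <= ls, 0 <= lc, 0 <= mc & 0 <= mu],
        [/\ ls < 1, 1 < mu, ls < mc & lc < mu] &
    [/\ forall v : 'rV[R]_d, (v <= S)%MS -> qform G (act F v) <= ls ^+ 2 * qform G v,
        forall v : 'rV[R]_d, (v <= C)%MS ->
          mc ^+ 2 * qform G v <= qform G (act F v) /\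
          qform G (act F v) <= lc ^+ 2 * qform G v &
        forall v : 'rV[R]_d, (v <= U)%MS -> mu ^+ 2 * qform G v <= qform G (act F v)]]].

Definition is_int_vec (R : realType) d (v : 'rV[R]_d) : Prop :=
  forall j, exists z : int, v 0 j = z%:~R.

Definition katznelson_irreducible (R : realType) d (C : 'M[R]_d) : Prop :=
  forall v : 'rV[R]_d, (v <= C)%MS -> is_int_vec v -> v = 0.

Definition projC (R : realType) d (S C U : 'M[R]_d) : 'M[R]_d :=
  proj_mx C (S + U)%MS.

Definition Ec (R : realType) d c (hcd : (c <= d)%N) (S C U : 'M[R]_d) : 'M[R]_(c, d) :=
  \matrix_(i < c) row (widen_ord hcd i) (projC S C U).

Definition normZ (R : realType) c (q : 'rV[int]_c) : R :=
  Num.sqrt (\sum_(j < c) ((q 0 j)%:~R) ^+ 2).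

Definition dotPq (R : realType) d c (P : 'M[R]_(d, c)) (i : 'I_d) (q : 'rV[int]_c) : R :=
  \sum_(j < c) P i j * (q 0 j)%:~R.

(* Main.v *)
Require Import Defs.
From HB Require Import structures.
From mathcomp Require Import all_boot all_order all_algebra.
From mathcomp Require Import reals.
From mathcomp Require Import boolp complex.
From mathcomp Require Import ring lra zify.
Set Implicit Arguments. Unset Strict Implicit. Unset Printing Implicit Defensive.
Import Order.TTheory GRing.Theory Num.Theory.
Local Open Scope ring_scope.

(* Write A = F^T, let pi be the projection to C along S + U, and let f be the
   characteristic polynomial of F on C.  A vector p with integer entries close
   to P q has (1 - pi) p small, where pi now acts on columns, so the theorem
   amounts to the lower bound |(1 - pi) p| >= K / |p|^c for nonzero integer
   columns p (Katznelson's lemma).  It follows from Dirichlet's simultaneous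
   approximation of the c lower coefficients of f, provided that f(A) is
   invertible off the range of pi and that this range contains no nonzero
   integer column.

   Both provisos rest on the fact that F has no common complex eigenvalue on C
   and on S or U.  For an eigenvalue l with eigenvector a + i b, the quadratic
   form G of the metric satisfies G(F a) + G(F b) = |l|^2 (G(a) + G(b)), so the
   domination inequalities bound |l| from both sides.  For the second proviso,
   let g be the characteristic polynomial of F^T on the rational Krylov space
   of an integer column in the range of pi: its roots are eigenvalues of F on C,
   so the kernel of g(F), which is rational and nonzero, lies in C, against
   irreducibility. *)

(** * Dirichlet's simultaneous approximation *)

(** Pigeonhole: the fractional parts of the [N ^ c + 1] points [k a], [0 <= k <= N ^ c], lie in a
    unit cube cut into [N ^ c] boxes of side [1 / N]. Two of them share a box, and the difference of
    their indices is the denominator. *)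
Lemma simultaneous_approximation (R : archiRealFieldType) (c N : nat)
    (a : 'I_c -> R) : (0 < N)%N ->
  exists (k : nat) (r : 'I_c -> int),
    [/\ (0 < k)%N, (k <= N ^ c)%N &
        forall j, `|k%:R * a j - (r j)%:~R| <= N%:R^-1].
Proof.
case: N => [//|N] _.
pose fr (x : R) := x - (Num.floor x)%:~R.
have fr_ge0 x : 0 <= fr x by rewrite subr_ge0 floor_le.
have fr_lt1 x : fr x < 1.
  by rewrite ltrBlDl; have := floorD1_gt x; rewrite intrD.
pose box (k : nat) (j : 'I_c) := Num.truncn (N.+1%:R * fr (k%:R * a j)).
have box_itv k j : (box k j)%:R <= N.+1%:R * fr (k%:R * a j) < (box k j).+1%:R.
  by apply: truncn_itv; rewrite mulr_ge0.
have box_lt k j : (box k j < N.+1)%N.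
  rewrite -(ltr_nat R); have /andP[h _] := box_itv k j.
  by apply: le_lt_trans h _; rewrite gtr_pMr.
pose h (k : 'I_(N.+1 ^ c).+1) := [ffun j => Ordinal (box_lt k j)].
have /injectivePn[k1 [k2 k12 hk]] : ~~ injectiveb h.
  apply/negP => /injectiveP /leq_card.
  by rewrite card_ffun !card_ord ltnn.
wlog lt12 : k1 k2 k12 hk / (k1 < k2)%N.
  move=> wl; case: (ltngtP k1 k2) => [lt|lt|/val_inj e].
  - exact: (wl k1 k2).
  - by apply: (wl k2 k1) => //; rewrite eq_sym.
  - by rewrite e eqxx in k12.
exists (k2 - k1)%N, (fun j => Num.floor (k2%:R * a j) - Num.floor (k1%:R * a j)).
split=> [||j]; first by rewrite subn_gt0.
  by apply: leq_trans (leq_subr _ _) _; rewrite -ltnS.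
have -> : (k2 - k1)%:R * a j - (Num.floor (k2%:R * a j) -
    Num.floor (k1%:R * a j))%:~R = fr (k2%:R * a j) - fr (k1%:R * a j).
  by rewrite natrB 1?ltnW // intrD rmorphN /= /fr; ring.
have /(congr1 val) /= : h k1 j = h k2 j by rewrite hk.
rewrite !ffunE /= => eb.
have := box_itv k1 j; have := box_itv k2 j; rewrite -eb -[(box k1 j).+1%:R]natr1.
set x := fr _; set y := fr _ => /andP[x1 x2] /andP[y1 y2].
rewrite -[_^-1]mul1r ler_pdivlMr // -{1}(normr_nat R N.+1) -normrM mulrC.
rewrite ler_norml mulrBr; apply/andP; split; lra.
Qed.

(** * A submultiplicative matrix norm *)

Definition mxl1 (R : numDomainType) m n (X : 'M[R]_(m, n)) : R :=
  \sum_i \sum_j `|X i j|.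

Section MxL1.
Context {R : realDomainType}.

Lemma mxl1_ge0 m n (X : 'M[R]_(m, n)) : 0 <= mxl1 X.
Proof. by apply: sumr_ge0 => i _; apply: sumr_ge0. Qed.

Lemma mxl1_entry m n (X : 'M[R]_(m, n)) i j : `|X i j| <= mxl1 X.
Proof.
rewrite /mxl1 (bigD1 i) //= (bigD1 j) //= -addrA lerDl addr_ge0 //.
  by apply: sumr_ge0.
by apply: sumr_ge0 => i' _; apply: sumr_ge0.
Qed.

Lemma mxl1_eq0 m n (X : 'M[R]_(m, n)) : mxl1 X <= 0 -> X = 0.
Proof.
move=> h; apply/matrixP => i j; rewrite mxE; apply/eqP.
by rewrite -normr_le0; apply: le_trans (mxl1_entry X i j) h.
Qed.

Lemma mxl1_int_lt1 m n (X : 'M[int]_(m, n)) :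
  mxl1 (map_mx intr X : 'M[R]_(m, n)) < 1 -> X = 0.
Proof.
move=> h; apply/matrixP => i j; rewrite mxE; apply/eqP.
rewrite -normr_le0 -ltzD1 add0r -(ltr_int R) intr_norm.
by apply: le_lt_trans h; have := mxl1_entry (map_mx intr X : 'M[R]_(m, n)) i j; rewrite mxE.
Qed.

Lemma mxl1D m n (X Y : 'M[R]_(m, n)) :
  mxl1 (X + Y) <= mxl1 X + mxl1 Y.
Proof.
rewrite /mxl1 -big_split ler_sum // => i _.
by rewrite -big_split ler_sum //= => j _; rewrite mxE ler_normD.
Qed.

Lemma mxl1Z m n a (X : 'M[R]_(m, n)) : mxl1 (a *: X) = `|a| * mxl1 X.
Proof.
rewrite /mxl1 mulr_sumr; apply: eq_bigr => i _.
by rewrite mulr_sumr; apply: eq_bigr => j _; rewrite mxE normrM.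
Qed.

Lemma mxl1_sum m n k (X : 'I_k -> 'M[R]_(m, n)) :
  mxl1 (\sum_i X i) <= \sum_i mxl1 (X i).
Proof.
elim/big_ind2: _ => // [|X1 x1 X2 x2 h1 h2].
  by rewrite /mxl1 big1 // => i _; rewrite big1 // => j _; rewrite mxE normr0.
by apply: le_trans (mxl1D _ _) _; rewrite lerD.
Qed.

Lemma mxl1M m n p (X : 'M[R]_(m, n)) (Y : 'M[R]_(n, p)) :
  mxl1 (X *m Y) <= mxl1 X * mxl1 Y.
Proof.
rewrite {1 2}/mxl1 mulr_suml ler_sum // => i _.
rewrite mulr_suml.
apply: (@le_trans _ _ (\sum_k \sum_j `|X i j| * `|Y j k|)).
  apply: ler_sum => k _; rewrite mxE; apply: le_trans (ler_norm_sum _ _ _) _.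
  by apply: ler_sum => j _; rewrite normrM.
rewrite exchange_big /= ler_sum // => j _.
rewrite -mulr_sumr ler_wpM2l // /mxl1 [leRHS](bigD1 j) //= lerDl.
by apply: sumr_ge0 => ? _; apply: sumr_ge0.
Qed.

End MxL1.

(** * Polynomials in a matrix, invariant subspaces and projections *)

(** Serves both for a basis [E] of an invariant space on which [A] acts by [B], and, with [B = A],
    for a projection [E] commuting with [A]. *)
Lemma horner_mx_intertwine (K : comNzRingType) m n (A : 'M[K]_n.+1)
    (B : 'M[K]_m.+1) (E : 'M[K]_(m.+1, n.+1)) p :
  E *m A = B *m E -> E *m horner_mx A p = horner_mx B p *m E.
Proof.
move=> EA; elim/poly_ind: p => [|p a IH].
  by rewrite !rmorph0 mulmx0 mul0mx.
rewrite !rmorphD !rmorphM /= !horner_mx_X !horner_mx_C -!mulmxE.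
by rewrite mulmxDr mulmxA IH mulmxDl -!mulmxA EA scalar_mxC.
Qed.

(** Apply the linear factors of [p] to [v] one after the other: the last nonzero vector before 0 is
    reached is an eigenvector, and it has not left [V]. *)
Lemma exists_eigenvector_sub (K : closedFieldType) m n (A : 'M[K]_n.+1)
    (V : 'M[K]_(m, n.+1)) (v : 'rV[K]_n.+1) (p : {poly K}) :
  (V *m A <= V)%MS -> (v <= V)%MS -> v != 0 -> p != 0 ->
  v *m horner_mx A p = 0 ->
  exists2 l, root p l &
    exists w : 'rV_n.+1, [/\ (w <= V)%MS, w != 0 & w *m A = l *: w].
Proof.
move=> VA + + p0; have [rs pE] := closed_field_poly_normal p.
have lp0 : lead_coef p != 0 by rewrite lead_coef_eq0.
have rootE l : root p l = (l \in rs) by rewrite pE rootZ // root_prod_XsubC.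
suff main (s : seq K) (u : 'rV_n.+1) : (u <= V)%MS -> u != 0 ->
    u *m horner_mx A (\prod_(z <- s) ('X - z%:P)) = 0 ->
    exists2 l, l \in s &
      exists w : 'rV_n.+1, [/\ (w <= V)%MS, w != 0 & w *m A = l *: w].
  move=> vV v0; rewrite {1}pE linearZ /= -scalemxAr => /eqP.
  rewrite scaler_eq0 (negPf lp0) /= => /eqP /(main _ _ vV v0)[l ls w].
  by exists l; rewrite ?rootE.
elim: s u => [|l s IH] u uV u0.
  by rewrite big_nil rmorph1 mulmx1 => u00; rewrite u00 eqxx in u0.
rewrite big_cons rmorphM /= -mulmxE mulmxA rmorphB /= horner_mx_X horner_mx_C.
rewrite mulmxBr mul_mx_scalar.
have [/eqP|uA0] := eqVneq (u *m A - l *: u) 0.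
  rewrite subr_eq0 => /eqP ul _; exists l; rewrite ?mem_head //.
  by exists u.
move=> uA; have [|l' ls' w] := IH _ _ uA0 uA.
  by rewrite addmx_sub ?eqmx_opp ?scalemx_sub // (submx_trans _ VA) // submxMr.
by exists l' => //; rewrite inE ls' orbT.
Qed.

Lemma proj_mx_comm (K : fieldType) n (A X Y : 'M[K]_n) :
  (X :&: Y = 0)%MS -> (X + Y :=: 1%:M)%MS ->
  (X *m A <= X)%MS -> (Y *m A <= Y)%MS ->
  A *m proj_mx X Y = proj_mx X Y *m A.
Proof.
move=> XY XY1 XA YA.
have YX : (Y :&: X = 0)%MS by rewrite capmxC.
have e : 1%:M = proj_mx X Y + proj_mx Y X.
  by rewrite -[RHS](mul1mx) mulmxDr add_proj_mx // XY1.
rewrite -{1}[A]mul1mx e !mulmxDl.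
rewrite [X in X + _]proj_mx_id //; last first.
  by rewrite (submx_trans _ XA) // submxMr // -[proj_mx _ _]mul1mx proj_mx_sub.
rewrite [X in _ + X]proj_mx_0 ?addr0 //.
by rewrite (submx_trans _ YA) // submxMr // -[proj_mx _ _]mul1mx proj_mx_sub.
Qed.

Lemma mxdirect3_cap0 (K : fieldType) n (S C U : 'M[K]_n) :
  mxdirect (S + C + U) ->
  [/\ (S :&: (C + U) = 0)%MS, (C :&: (S + U) = 0)%MS & (U :&: (S + C) = 0)%MS].
Proof.
rewrite mxdirectE /= => /eqP rk.
have aux (X Y Z : 'M[K]_n) : \rank (X + (Y + Z))%MS =
    (\rank X + (\rank Y + \rank Z))%N -> (X :&: (Y + Z) = 0)%MS.
  move=> e; apply/eqP; rewrite -mxrank_eq0.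
  have := mxrank_sum_cap X (Y + Z)%MS; rewrite e.
  have := mxrank_sum_cap Y Z; lia.
split; apply: aux.
- by rewrite addsmxA rk addnA.
- by rewrite addsmxA (addsmxC C S) rk addnCA addnA.
- by rewrite addsmxC rk addnC.
Qed.

(** * Complex eigenvalues, and how the metric separates them *)

Section ComplexSpectrum.
Context {R : realType}.
Local Notation toC := (real_complex R).

Lemma Re_mulC (x : R[i]) (y : R) : complex.Re (x * toC y) = complex.Re x * y.
Proof. by case: x => a b /=; rewrite mulr0 subr0. Qed.

Lemma Im_mulC (x : R[i]) (y : R) : complex.Im (x * toC y) = complex.Im x * y.
Proof. by case: x => a b /=; rewrite mulr0 add0r. Qed.

Lemma map_Re_mul m n p (X : 'M[R[i]]_(m, n)) (Y : 'M[R]_(n, p)) :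
  map_mx (@complex.Re R) (X *m map_mx toC Y) = map_mx (@complex.Re R) X *m Y.
Proof.
apply/matrixP => i j; rewrite !mxE.
rewrite (big_morph (@complex.Re R) (id1 := 0) (op1 := +%R)) //; last by case=> ? ? [].
by apply: eq_bigr => k _; rewrite !mxE Re_mulC.
Qed.

Lemma map_Im_mul m n p (X : 'M[R[i]]_(m, n)) (Y : 'M[R]_(n, p)) :
  map_mx (@complex.Im R) (X *m map_mx toC Y) = map_mx (@complex.Im R) X *m Y.
Proof.
apply/matrixP => i j; rewrite !mxE.
rewrite (big_morph (@complex.Im R) (id1 := 0) (op1 := +%R)) //; last by case=> ? ? [].
by apply: eq_bigr => k _; rewrite !mxE Im_mulC.
Qed.

Definition complex_eigenvalue_on n (A V : 'M[R]_n) (l : R[i]) : Prop :=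
  exists w : 'rV[R[i]]_n,
    [/\ (w <= map_mx toC V)%MS, w != 0 & w *m map_mx toC A = l *: w].

Lemma complex_eigenvalue_onP n (A V : 'M[R]_n) l :
  complex_eigenvalue_on A V l ->
  exists a b : 'rV[R]_n,
    [/\ (a <= V)%MS, (b <= V)%MS, (a != 0) || (b != 0),
        a *m A = complex.Re l *: a - complex.Im l *: b & b *m A = complex.Re l *: b + complex.Im l *: a].
Proof.
case=> w [/submxP[z wz] w0 wA].
exists (map_mx (@complex.Re R) w), (map_mx (@complex.Im R) w); split.
- by rewrite wz map_Re_mul submxMl.
- by rewrite wz map_Im_mul submxMl.
- rewrite -negb_and; apply: contra w0 => /andP[/eqP re /eqP im].
  apply/eqP/matrixP => i j; rewrite mxE.
  move/matrixP/(_ i j): re; move/matrixP/(_ i j): im; rewrite !mxE.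
  by case: (w i j) => x y /= -> ->.
- rewrite -map_Re_mul wA; apply/matrixP => i j; rewrite !mxE.
  by case: l {wA} (w i j) => x y [].
- rewrite -map_Im_mul wA; apply/matrixP => i j; rewrite !mxE.
  by case: l {wA} (w i j) => x y [] /= *; rewrite addrC mulrC; ring.
Qed.

(** The two cross terms are opposite because [G] is symmetric. *)
Lemma qform_rotation n (G : 'M[R]_n) (a b : 'rV[R]_n) (x y : R) : G^T = G ->
  qform G (x *: a - y *: b) + qform G (x *: b + y *: a) =
  (x ^+ 2 + y ^+ 2) * (qform G a + qform G b).
Proof.
move=> GT.
have bl (s t : R) (u v w : 'rV[R]_n) : ((s *: u + t *: v) *m G *m w^T) 0 0 =
    s * (u *m G *m w^T) 0 0 + t * (v *m G *m w^T) 0 0.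
  by rewrite !mulmxDl -!scalemxAl !mxE.
have sym (u v : 'rV[R]_n) : (u *m G *m v^T) 0 0 = (v *m G *m u^T) 0 0.
  have -> : u *m G *m v^T = (v *m G *m u^T)^T.
    by rewrite !trmx_mul GT trmxK mulmxA.
  by rewrite mxE.
rewrite /qform -scaleNr !bl !(sym _ (_ + _)) !bl (sym b a); ring.
Qed.

Lemma complex_eigenvalue_on_le n (G A V : 'M[R]_n) (t : R) l :
  inner_product_mx G -> complex_eigenvalue_on A V l ->
  (forall v : 'rV[R]_n, (v <= V)%MS -> qform G (v *m A) <= t * qform G v) ->
  complex.Re l ^+ 2 + complex.Im l ^+ 2 <= t.
Proof.
move=> [GT Gpos] /complex_eigenvalue_onP[a [b [aV bV ab0 aA bA]]] h.
have qge0 v : 0 <= qform G v.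
  have [->|v0] := eqVneq v 0; last exact/ltW/Gpos.
  by rewrite /qform !mul0mx mxE.
have ab_gt0 : 0 < qform G a + qform G b.
  by case/orP: ab0 => /Gpos ?; [apply: ltr_pwDl|apply: ltr_wpDl].
rewrite -(ler_pM2r ab_gt0) -qform_rotation // -aA -bA mulrDr.
by apply: lerD; apply: h.
Qed.

Lemma complex_eigenvalue_on_ge n (G A V : 'M[R]_n) (t : R) l :
  inner_product_mx G -> complex_eigenvalue_on A V l ->
  (forall v : 'rV[R]_n, (v <= V)%MS -> t * qform G v <= qform G (v *m A)) ->
  t <= complex.Re l ^+ 2 + complex.Im l ^+ 2.
Proof.
move=> [GT Gpos] /complex_eigenvalue_onP[a [b [aV bV ab0 aA bA]]] h.
have qge0 v : 0 <= qform G v.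
  have [->|v0] := eqVneq v 0; last exact/ltW/Gpos.
  by rewrite /qform !mul0mx mxE.
have ab_gt0 : 0 < qform G a + qform G b.
  by case/orP: ab0 => /Gpos ?; [apply: ltr_pwDl|apply: ltr_wpDl].
rewrite -(ler_pM2r ab_gt0) -qform_rotation // -aA -bA mulrDr.
by apply: lerD; apply: h.
Qed.

Lemma center_spectrum_disjoint n (F : 'M[int]_n) (S C U : 'M[R]_n) l :
  partially_hyperbolic F S C U ->
  complex_eigenvalue_on (mxR R F)^T C l ->
  ~ complex_eigenvalue_on (mxR R F)^T S l /\
  ~ complex_eigenvalue_on (mxR R F)^T U l.
Proof.
case=> _ _ _ [G [Gip [ls [lc [mc [mu [[ls0 lc0 mc0 mu0] [_ _ lsmc lcmu]]
  [hS hC hU]]]]]]] lC.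
have Cge := complex_eigenvalue_on_ge Gip lC (fun v vC => (hC v vC).1).
have Cle := complex_eigenvalue_on_le Gip lC (fun v vC => (hC v vC).2).
split=> [/(complex_eigenvalue_on_le Gip)/(_ hS)|
         /(complex_eigenvalue_on_ge Gip)/(_ hU)] h.
- by have := le_trans Cge h; rewrite leNgt ltr_pXn2r ?lsmc.
- by have := le_trans h Cle; rewrite leNgt ltr_pXn2r ?lcmu.
Qed.

(** The projection to [V] commutes with [A], so the [V]-component of [v] is killed by [p(A)] as
    well. Were it nonzero, it would produce a complex eigenvector in [V] whose eigenvalue is a root
    of [p]. *)
Lemma kernel_horner_invariant n (A V W : 'M[R]_n.+1) (p : {poly R})
    (v : 'rV[R]_n.+1) :
  (V :&: W = 0)%MS -> (V + W :=: 1%:M)%MS ->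
  (V *m A <= V)%MS -> (W *m A <= W)%MS -> p != 0 ->
  (forall l, root (map_poly toC p) l -> ~ complex_eigenvalue_on A V l) ->
  v *m horner_mx A p = 0 -> v *m proj_mx V W = 0.
Proof.
move=> VW VW1 VA WA p0 noeig vp; apply/eqP; apply: contraT => v0.
have piA := proj_mx_comm VW VW1 VA WA.
have e : v *m proj_mx V W *m horner_mx A p = 0.
  by rewrite -mulmxA (horner_mx_intertwine _ (esym piA)) mulmxA vp mul0mx.
have [|||||l lp [w [wV w0 wA]]] := @exists_eigenvector_sub R[i] _ _ (map_mx toC A)
   (map_mx toC V) (map_mx toC (v *m proj_mx V W)) (map_poly toC p).
- by rewrite -map_mxM map_submx.
- by rewrite map_submx proj_mx_sub.
- by rewrite map_mx_eq0.
- by rewrite map_poly_eq0.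
- by rewrite -map_horner_mx -map_mxM e map_mx0.
by case: (noeig l lp); exists w.
Qed.

(** By disjointness of the spectra, the components of [v] along [S] and along [U] both vanish. *)
Lemma kernel_horner_center n (F : 'M[int]_n.+1) (S C U : 'M[R]_n.+1)
    (p : {poly R}) (v : 'rV[R]_n.+1) :
  partially_hyperbolic F S C U -> p != 0 ->
  (forall l, root (map_poly toC p) l ->
             complex_eigenvalue_on (mxR R F)^T C l) ->
  v *m horner_mx (mxR R F)^T p = 0 -> (v <= C)%MS.
Proof.
move=> ph p0 pC vp.
have [[SA CA UA] dir SCU _] := ph.
have [capS capC capU] := mxdirect3_cap0 dir.
have invD (X Y : 'M[R]_n.+1) : Defs.invariant F X -> Defs.invariant F Y ->
    Defs.invariant F (X + Y)%MS.
  by move=> XA YA; rewrite /Defs.invariant addsmxMr addsmxS.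
have vS : v *m proj_mx S (C + U)%MS = 0.
  apply: (kernel_horner_invariant (A := (mxR R F)^T) (p := p)) => //.
  - by apply: eqmx_trans SCU; apply/eqmxP; rewrite !addsmxA !submx_refl.
  - exact: invD.
  - by move=> l /pC /(center_spectrum_disjoint ph)[].
have vU : v *m proj_mx U (S + C)%MS = 0.
  apply: (kernel_horner_invariant (A := (mxR R F)^T) (p := p)) => //.
  - by apply: eqmx_trans SCU; apply/eqmxP; rewrite addsmxC !submx_refl.
  - exact: invD.
  - by move=> l /pC /(center_spectrum_disjoint ph)[].
have : (v <= S + C + U)%MS by rewrite SCU submx1.
case/sub_addsmxP=> -[x y] /= vE.
have xSC : (x *m (S + C)%MS <= S + C)%MS by rewrite submxMl.
have yU0 : y *m U = 0.
  rewrite -vU vE mulmxDl [X in X + _]proj_mx_0 //.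
  by rewrite add0r proj_mx_id ?submxMl.
move: vE; rewrite yU0 addr0 => vE; move: xSC; rewrite -vE.
case/sub_addsmxP=> -[x' y'] /= vE'.
have xS0 : x' *m S = 0.
  rewrite -vS vE' mulmxDl [X in _ + X]proj_mx_0 ?addr0; last first.
  - by rewrite (submx_trans (submxMl _ _)) // addsmxSl.
  - exact: capS.
  by rewrite proj_mx_id ?submxMl.
by rewrite vE' xS0 add0r submxMl.
Qed.

End ComplexSpectrum.

(** * Passage between rows and columns, and Krylov spaces *)

Lemma horner_mx_tr (K : comNzRingType) n (A : 'M[K]_n.+1) p :
  horner_mx A^T p = (horner_mx A p)^T.
Proof.
elim/poly_ind: p => [|p a IH]; first by rewrite !rmorph0 trmx0.
rewrite !rmorphD !rmorphM /= !horner_mx_X !horner_mx_C IH -!mulmxE.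
by rewrite linearD /= tr_scalar_mx -trmx_mul (comm_horner_mx p (comm_mx_refl A)).
Qed.

Lemma singular_exists_row (K : fieldType) n (N : 'M[K]_n) (z : 'cV[K]_n) :
  z != 0 -> N *m z = 0 -> exists2 u : 'rV[K]_n, u != 0 & u *m N = 0.
Proof.
move=> z0 Nz; have [k0|] := eqVneq (kermx N) 0.
  have Nu : N \in unitmx by rewrite -row_free_unit -kermx_eq0 k0.
  by rewrite -(mulKmx Nu z) Nz mulmx0 eqxx in z0.
by move=> /rowV0Pn[u /sub_kermxP uN u0]; exists u.
Qed.

Lemma col_to_row_eigenvector (K : fieldType) n (A pi : 'M[K]_n) l
    (z : 'cV[K]_n) :
  A *m pi = pi *m A -> pi *m pi = pi ->
  z != 0 -> pi *m z = z -> A *m z = l *: z ->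
  exists u : 'rV[K]_n, [/\ u != 0, u *m pi = u & u *m A = l *: u].
Proof.
move=> Api pipi z0 piz Az.
(* This matrix is [A - l] on the range of [pi] and the identity on its kernel. It kills [z], and any
   row in its left kernel is an eigenvector fixed by [pi]. *)
have [|u u0 uN] := @singular_exists_row _ _ (pi *m A - l *: pi + (1%:M - pi)) z z0.
  rewrite !mulmxDl !mulNmx -scalemxAl -mulmxA Az -scalemxAr piz mul1mx.
  by rewrite !subrr addr0.
have upi : u *m pi = u.
  have /(congr1 (mulmx^~ (1%:M - pi))) := uN.
  rewrite mul0mx -mulmxA mulmxDl mulmxBl -scalemxAl !mulmxBr !mulmxBl.
  rewrite !mulmx1 !mul1mx pipi -mulmxA Api mulmxA pipi !subrr.
  by rewrite scaler0 subrr subr0 add0r mulmxBr mulmx1 => /eqP; rewrite subr_eq0 => /eqP.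
exists u; split=> //; apply/eqP; rewrite -subr_eq0; apply/eqP.
move: uN; rewrite !mulmxDr !mulmxN -scalemxAr mulmxA upi mulmx1.
by rewrite subrr addr0.
Qed.

(** By the minimal polynomial, finitely many iterates of [v] span an invariant space. The matrix [D]
    keeps the basis expressed in these iterates, so that linear relations satisfied by all of them
    pass to [L]. *)
Lemma krylov_row_base (K : fieldType) n (T : 'M[K]_n.+1) (v : 'rV[K]_n.+1) :
  v != 0 -> exists k (L : 'M[K]_(k.+1, n.+1)) (B : 'M[K]_k.+1),
    [/\ row_free L, (v <= L)%MS, L *m T = B *m L &
        exists d (D : 'M[K]_(k.+1, d)), L = D *m \matrix_(i < d) (v *m T ^+ i)].
Proof.
move=> v0; pose d := degree_mxminpoly T.
pose L := \matrix_(i < d) (v *m T ^+ i).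
have LE : L = powers_mx T d *m lin_mul_row v.
  by apply/row_matrixP => i; rewrite row_mul !rowK mul_vec_lin_row.
have memL p : (v *m horner_mx T p <= L)%MS.
  by rewrite LE -mul_vec_lin_row submxMr // horner_mx_mem.
have vL : (v <= L)%MS by have := memL 1; rewrite rmorph1 mulmx1.
have LT : (L *m T <= L)%MS.
  apply/row_subP => i; rewrite row_mul rowK -mulmxA mulmxE.
  by have := memL ('X ^+ i * 'X); rewrite rmorphM rmorphXn /= horner_mx_X.
have [k [L' [eL fL]]] : exists k (L' : 'M[K]_(k, n.+1)), (L' :=: L)%MS /\ row_free L'.
  by exists (\rank L), (row_base L); split; [exact: eq_row_base|exact: row_base_free].
case: k L' eL fL => [|k] L' eL fL.
  have : (v <= L')%MS by rewrite eL.
  by rewrite (flatmx0 L') => /submx0null; move/eqP: v0.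
exists k, L', (L' *m T *m pinvmx L'); split=> //; first by rewrite eL.
  by rewrite mulmxKpV // eL (eqmxMr T eL).
by exists d, (L' *m pinvmx L); rewrite mulmxKpV // eL.
Qed.

Lemma rat_row_common_denominator n (u : 'rV[rat]_n) :
  exists2 N : int, N != 0 &
    forall j, exists z : int, N%:~R * u 0 j = z%:~R.
Proof.
exists (\prod_j denq (u 0 j)); first by apply/prodf_neq0 => j _; rewrite denq_neq0.
move=> j; exists (numq (u 0 j) * \prod_(i | i != j) denq (u 0 i)).
by rewrite (bigD1 j) //= !intrM numqE; ring.
Qed.

(** * Irreducibility for columns: no nonzero integer column in the range of [pi] *)

Section DualIrreducibility.
Context {R : realType}.
Local Notation toC := (real_complex R).

Lemma projC_facts n (F : 'M[int]_n) (S C U : 'M[R]_n) :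
  partially_hyperbolic F S C U ->
  [/\ (mxR R F)^T *m projC S C U = projC S C U *m (mxR R F)^T,
      projC S C U *m projC S C U = projC S C U,
      (projC S C U <= C)%MS & forall m (v : 'M[R]_(m, n)),
      (v <= C)%MS -> v *m projC S C U = v].
Proof.
move=> ph; have [[SA CA UA] dir SCU _] := ph.
have [capS capC capU] := mxdirect3_cap0 dir.
have idC m (v : 'M[R]_(m, n)) : (v <= C)%MS -> v *m projC S C U = v.
  exact: proj_mx_id.
have subC : (projC S C U <= C)%MS by rewrite -[projC _ _ _]mul1mx proj_mx_sub.
split=> //; last exact: idC.
apply: proj_mx_comm => //; last by rewrite addsmxMr addsmxS.
by apply: eqmx_trans SCU; apply/eqmxP; rewrite addsmxA (addsmxC C S) !submx_refl.
Qed.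

Lemma dual_katznelson_irreducible n (F : 'M[int]_n.+1) (S C U : 'M[R]_n.+1)
    (p : 'cV[int]_n.+1) :
  partially_hyperbolic F S C U -> katznelson_irreducible C ->
  projC S C U *m map_mx intr p = map_mx intr p -> p = 0.
Proof.
move=> ph irr pip; apply/eqP; apply: contraT => p0.
have [piA pipi subC idC] := projC_facts ph.
set pi := projC S C U in pip piA pipi subC idC *.
set A := (mxR R F)^T in piA.
pose v : 'rV[rat]_n.+1 := map_mx intr p^T.
pose T : 'M[rat]_n.+1 := map_mx intr F.
have map_int m m' (X : 'M[int]_(m, m')) :
    map_mx (ratr : rat -> R) (map_mx intr X) = map_mx intr X.
  by apply/matrixP => i j; rewrite !mxE ratr_int.
have v0 : v != 0.
  apply: contra p0 => /eqP/matrixP h; apply/eqP/matrixP => i j.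
  by have := h j i; rewrite !mxE => /eqP; rewrite intr_eq0 => /eqP.
have [k [L [B [fL vL LT [d [D LD]]]]]] := krylov_row_base T v0.
pose g := char_poly B.
have vg : v *m horner_mx T g = 0.
  have /submxP[w ->] := vL.
  rewrite -mulmxA (horner_mx_intertwine _ LT) Cayley_Hamilton.
  by rewrite mul0mx mulmx0.
(* The column [v^T] shows that [g(T^T)] is singular; its left kernel then supplies a rational vector
   [u]. *)
have [||u u0 ug] := @singular_exists_row _ _ (horner_mx T^T g) v^T.
- by rewrite -trmx0 (inj_eq trmx_inj).
- by rewrite horner_mx_tr -trmx_mul vg trmx0.
(* Every iterate of [v] is fixed by [pi^T], since [pi] fixes [p] and commutes with [A]. *)
have LR : map_mx (ratr : rat -> R) L *m pi^T = map_mx ratr L.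
  rewrite LD map_mxM -mulmxA; congr (_ *m _).
  apply/row_matrixP => i; rewrite row_mul -map_row rowK map_mxM map_int.
  rewrite -mulmxA (rmorphXn (map_mx (ratr : rat -> R))) /= map_int.
  have -> : map_mx intr F ^+ i *m pi^T = pi^T *m (map_mx intr F : 'M[R]_n.+1) ^+ i.
    have := @horner_mx_intertwine R n n (map_mx intr F) (map_mx intr F) pi^T ('X^i).
    rewrite !rmorphXn /= !horner_mx_X => -> //.
    by have := congr1 trmx piA; rewrite !trmx_mul trmxK.
  by rewrite mulmxA -map_trmx -trmx_mul pip.
have eig l : root (map_poly toC (map_poly (ratr : rat -> R) g)) l ->
    complex_eigenvalue_on A C l.
  rewrite !map_char_poly -eigenvalue_root_char => /eigenvalueP[w wB w0].
  pose LC := map_mx toC (map_mx (ratr : rat -> R) L).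
  have fLC : row_free LC by rewrite /row_free !mxrank_map.
  have LTC : LC *m (map_mx toC A)^T = map_mx toC (map_mx ratr B) *m LC.
    rewrite /LC map_trmx trmxK /mxR -map_int -!map_mxM.
    by congr (map_mx _ (map_mx _ _)).
  (* The transpose of [w *m LC] is a column eigenvector of [A] in the range of [pi]; it is exchanged
     for a row eigenvector, which lies in [C]. *)
  have [|||||x [x0 xpi xA]] := @col_to_row_eigenvector _ _ (map_mx toC A)
      (map_mx toC pi) l (w *m LC)^T.
  - by rewrite -!map_mxM piA.
  - by rewrite -!map_mxM pipi.
  - rewrite -trmx0 (inj_eq trmx_inj); apply: contra w0 => /eqP.
    by rewrite -[X in _ = X](mul0mx _ LC) => /(row_free_inj fLC) ->.
  - rewrite -[map_mx toC pi]trmxK -trmx_mul -mulmxA map_trmx.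
    by rewrite /LC -map_mxM LR.
  - rewrite -[map_mx toC A]trmxK -trmx_mul -mulmxA LTC mulmxA wB.
    by rewrite -scalemxAl linearZ.
  by exists x; split=> //; rewrite -xpi mulmx_sub // map_submx.
have g0 : map_poly (ratr : rat -> R) g != 0.
  by rewrite map_poly_eq0 monic_neq0 // char_poly_monic.
have uC : (map_mx (ratr : rat -> R) u <= C)%MS.
  apply: (kernel_horner_center ph g0 eig).
  have -> : (mxR R F)^T = map_mx (ratr : rat -> R) T^T by rewrite -map_trmx map_int.
  by rewrite -map_horner_mx -map_mxM ug map_mx0.
have [N N0 Nu] := rat_row_common_denominator u.
have : (N%:~R : R) *: map_mx ratr u = 0.
  apply: irr; first by rewrite scalemx_sub.
  move=> j; have [z hz] := Nu j; exists z.
  by rewrite !mxE -(ratr_int R z) -hz rmorphM /= ratr_int.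
move/eqP; rewrite scaler_eq0 intr_eq0 (negPf N0) /= map_mx_eq0.
by rewrite (negPf u0).
Qed.

End DualIrreducibility.

(** * Katznelson's lemma *)

Lemma horner_mx_monic (K : comNzRingType) n (A : 'M[K]_n.+1) c (f : {poly K}) :
  f \is monic -> size f = c.+1 ->
  horner_mx A f = A ^+ c + \sum_(j < c) f`_j *: A ^+ j.
Proof.
move=> /monicP lf sf; rewrite -{1}[f]coefK poly_def rmorph_sum sf big_ord_recr /=.
have -> : f`_c = 1 by rewrite -lf lead_coefE sf.
rewrite scale1r rmorphXn /= horner_mx_X addrC; congr (_ + _).
by apply: eq_bigr => j _; rewrite linearZ /= rmorphXn /= horner_mx_X.
Qed.

(* Dirichlet approximates the coefficients of [f] by rationals with a common
   denominator [k].  The resulting integer polynomial in [A] maps [p] to an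
   integer vector of norm less than 1, hence to 0; since that polynomial is
   invertible off the range of [pi], this forces [p = pi p]. *)
Lemma katznelson_lemma (R : realType) n c (A0 : 'M[int]_n.+1) (pi : 'M[R]_n.+1)
    (f : {poly R}) :
  let A : 'M[R]_n.+1 := map_mx intr A0 in
  f \is monic -> size f = c.+1 ->
  A *m pi = pi *m A -> pi *m pi = pi -> horner_mx A f *m pi = 0 ->
  horner_mx A f + pi \in unitmx ->
  (forall p : 'cV[int]_n.+1, pi *m map_mx intr p = map_mx intr p -> p = 0) ->
  exists2 K : R, 0 < K & forall p : 'cV[int]_n.+1, p != 0 ->
    K <= mxl1 (map_mx intr p - pi *m map_mx intr p) *
         mxl1 (map_mx intr p : 'cV[R]_n.+1) ^+ c.
Proof.
move=> A fmonic fsize Api pipi fpi Munit piint.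
set fA := horner_mx A f in fpi Munit *.
pose D : R := \sum_(j < c) mxl1 (A ^+ j).
pose I := mxl1 (invmx (fA + pi)).
pose W := mxl1 fA.
have D0 : 0 <= D by apply: sumr_ge0 => j _; apply: mxl1_ge0.
have I0 : 0 <= I by apply: mxl1_ge0.
have W0 : 0 <= W by apply: mxl1_ge0.
(* As [T >= 1], any [Q > b * T] gives both [D * T / Q <= 1/2], which bounds [del *m x], and
   [I * D / Q <= 1/2], which makes the final estimate a contraction. *)
pose b := 2 * (D + I * D) + 1.
have b0 : 0 < b by rewrite /b; have := mulr_ge0 I0 D0; lra.
have X0 : 0 <= (b + 1) ^+ c * W by rewrite mulr_ge0 // exprn_ge0 //; lra.
(* Since [k <= Q ^ c <= ((b + 1) * T) ^ c], this constant makes [k f(A) y] smaller than 1/2. *)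
exists (2 * ((b + 1) ^+ c * W) + 1)^-1; first by rewrite invr_gt0; lra.
move=> p p0; set x : 'cV[R]_n.+1 := map_mx intr p.
set y := x - pi *m x; set T := mxl1 x.
have T1 : 1 <= T.
  rewrite leNgt; apply: contra p0 => lt1; apply/eqP.
  exact: (@mxl1_int_lt1 R).
rewrite leNgt; apply/negP => small.
have Y0 : 0 <= mxl1 y := mxl1_ge0 y.
have small' : mxl1 y * T ^+ c * ((b + 1) ^+ c * W) < 2^-1.
  have h : 0 < 2 * ((b + 1) ^+ c * W) + 1 by lra.
  move: small; rewrite -[_^-1]mul1r ltr_pdivlMr //.
  set z := _ * T ^+ c; set w := _ * W => zw.
  have z0 : 0 <= z by rewrite mulr_ge0 // exprn_ge0 //; lra.
  have [->|zn0] := eqVneq z 0; first by rewrite mul0r invr_gt0.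
  have : 0 < z by rewrite lt_def zn0.
  lra.
pose Q := (Num.truncn (b * T)).+1.
have /andP[Q1 Q2] : ((Num.truncn (b * T))%:R <= b * T < Q%:R).
  by apply: truncn_itv; rewrite mulr_ge0 //; lra.
have Q0 : 0 < Q%:R :> R by rewrite ltr0n.
have Qle : Q%:R <= (b + 1) * T by rewrite /Q -natr1; lra.
have [k [r [k0 kQ rk]]] := @simultaneous_approximation R c Q (fun j => f`_j) isT.
pose N0 : 'M[int]_n.+1 := k%:R *: A0 ^+ c + \sum_(j < c) r j *: A0 ^+ j.
pose del : 'M[R]_n.+1 := \sum_(j < c) (k%:R * f`_j - (r j)%:~R) *: A ^+ j.
have N0E : map_mx intr N0 = k%:R *: fA - del.
  rewrite /N0 map_mxD map_mxZ rmorphXn /= -/A rmorph_nat.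
  rewrite (big_morph (map_mx (intr : int -> R)) (id1 := 0) (op1 := +%R));
    [|exact: map_mxD|exact: map_mx0].
  rewrite /fA (horner_mx_monic _ fmonic fsize) scalerDr -addrA; congr (_ + _).
  rewrite scaler_sumr /del -sumrB; apply: eq_bigr => j _.
  by rewrite map_mxZ rmorphXn /= -/A scalerBl scalerA opprB addrCA subrr addr0.
have delle : mxl1 del <= D / Q%:R.
  apply: le_trans (mxl1_sum _) _; rewrite /D mulr_suml ler_sum // => j _.
  by rewrite mxl1Z mulrC ler_wpM2l ?mxl1_ge0.
have fAx : fA *m x = fA *m y by rewrite mulmxBr mulmxA fpi mul0mx subr0.
have N0p : N0 *m p = 0.
  apply: (@mxl1_int_lt1 R); rewrite map_mxM N0E mulmxBl -scalemxAl -/x fAx.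
  apply: le_lt_trans (mxl1D _ _) _.
  rewrite -scaleN1r !mxl1Z normrN1 mul1r normr_nat.
  have h1 : mxl1 (del *m x) <= 2^-1.
    apply: le_trans (mxl1M _ _) _.
    apply: (@le_trans _ _ (D / Q%:R * T)); first by rewrite ler_wpM2r // mxl1_ge0.
    rewrite mulrAC ler_pdivrMr //.
    have := mulr_ge0 I0 D0; have : 0 <= I * D * T by rewrite !mulr_ge0 //; lra.
    move: Q2; rewrite /b; lra.
  have h2 : k%:R * mxl1 (fA *m y) < 2^-1.
    apply: le_lt_trans small'.
    apply: (@le_trans _ _ (((b + 1) * T) ^+ c * (W * mxl1 y))); last first.
      by rewrite exprMn le_eqVlt; apply/orP; left; apply/eqP; ring.
    apply: ler_pM => //; [exact: mxl1_ge0| |exact: mxl1M].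
    apply: (@le_trans _ _ ((Q ^ c)%:R)); first by rewrite ler_nat.
    by rewrite natrX lerXn2r // nnegrE; lra.
  lra.
have piX (h : {poly R}) : pi *m horner_mx A h = horner_mx A h *m pi.
  exact/horner_mx_intertwine/esym.
have delcomm : pi *m del = del *m pi.
  rewrite /del mulmx_sumr mulmx_suml; apply: eq_bigr => j _.
  rewrite -scalemxAl -scalemxAr; congr (_ *: _).
  by have := piX 'X^j; rewrite rmorphXn /= horner_mx_X.
(* From [N0 p = 0] one gets [k f(A) x = del x]. Applying [pi] kills the left side, so [del] kills
   [pi x] and [x] may be replaced by [y]. *)
have yE : k%:R *: (fA *m y) = del *m y.
  have e : k%:R *: (fA *m x) = del *m x.
    apply/eqP; rewrite -subr_eq0 scalemxAl -mulmxBl -N0E -map_mxM N0p.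
    by rewrite map_mx0.
  by rewrite -fAx e mulmxBr mulmxA -delcomm -mulmxA -e -scalemxAr mulmxA piX fpi
    mul0mx scaler0 subr0.
have piy : pi *m y = 0 by rewrite mulmxBr mulmxA pipi subrr.
have yE' : k%:R *: y = invmx (fA + pi) *m (del *m y).
  by rewrite -yE -scalemxAr -[fA *m y]addr0 -piy -mulmxDl mulKmx.
have y0 : y = 0.
  apply: mxl1_eq0.
  (* As [pi y = 0], inverting [f(A) + pi] bounds [k y], hence [y] because [k >= 1]. *)
  have h1 : mxl1 y <= I * D / Q%:R * mxl1 y.
    have : mxl1 (k%:R *: y) <= I * (D / Q%:R * mxl1 y).
      rewrite yE'; apply: le_trans (mxl1M _ _) _; rewrite ler_wpM2l //.
      by apply: le_trans (mxl1M _ _) _; rewrite ler_wpM2r.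
    rewrite mxl1Z normr_nat !mulrA; apply: le_trans.
    by rewrite ler_peMl // ler1n.
  have h2 : I * D / Q%:R <= 2^-1.
    rewrite ler_pdivrMr //; have := mulr_ge0 I0 D0.
    have : 2 * (D + I * D) + 1 <= b * T by rewrite -/b ler_peMr // ltW.
    move: Q2; lra.
  have := ler_wpM2r Y0 h2; lra.
move/eqP: p0; apply; apply: piint; rewrite -/x.
by apply/eqP; rewrite eq_sym -subr_eq0 -/y y0.
Qed.

(** * Comparison of norms on integer vectors *)

Section IntegerVectors.
Context {R : realType}.

Lemma normZ_ge1 c (q : 'rV[int]_c) : q != 0 -> 1 <= normZ R q.
Proof.
case/rV0Pn=> j qj.
rewrite -[leLHS]sqrtr1 ler_wsqrtr // (bigD1 j) //=.
apply: (@le_trans _ _ ((q 0 j)%:~R ^+ 2)).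
  rewrite -rmorphXn /= -[1]/(1%:~R) ler_int -gtz0_ge1 exprn_even_gt0 //=.
by rewrite lerDl sumr_ge0 // => i _; apply: sqr_ge0.
Qed.

Lemma mxl1_le_normZ c (q : 'rV[int]_c) :
  mxl1 (map_mx intr q : 'rV[R]_c) <= c%:R * normZ R q.
Proof.
have -> : c%:R * normZ R q = \sum_(j < c) normZ R q.
  by rewrite sumr_const card_ord mulr_natl.
rewrite /mxl1 big_ord1 ler_sum // => j _.
rewrite mxE -sqrtr_sqr ler_wsqrtr // (bigD1 j) //=.
by rewrite lerDl sumr_ge0 // => i _; apply: sqr_ge0.
Qed.

Lemma mxl1_col_le d (e : 'cV[R]_d) t :
  (forall i, `|e i 0| <= t) -> mxl1 e <= d%:R * t.
Proof.
move=> h; have -> : d%:R * t = \sum_(i < d) t.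
  by rewrite sumr_const card_ord mulr_natl.
rewrite /mxl1 ler_sum // => i _.
by rewrite big_ord1.
Qed.

End IntegerVectors.

(** * From Katznelson's lemma to the Diophantine bound *)

Theorem theorem3p3 (R : realType) (d c : nat) (hcd : (c <= d)%N)
    (F : 'M[int]_d) (S C U : 'M[R]_d) (P : 'M[R]_(d, c)) :
  \det F = 1 ->
  partially_hyperbolic F S C U ->
  \rank C = c ->
  katznelson_irreducible C ->
  row_free (Ec hcd S C U) ->
  P *m Ec hcd S C U = projC S C U ->
  exists K : R, 0 < K /\
    forall q : 'rV[int]_c, q != 0 ->
      exists i : 'I_d, forall p : int,
        K / normZ R q ^+ c < `|dotPq P i q - p%:~R|.
Proof.
move=> _ ph _ irr Efree PE.
case: c hcd P Efree PE => [|c] hcd P Efree PE.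
  by exists 1; split=> // q; rewrite thinmx0 eqxx.
case: d hcd F S C U P ph irr Efree PE => [//|d] hcd F S C U P ph irr Efree PE.
have [piA pipi subC idC] := projC_facts ph.
set E := Ec hcd S C U in Efree PE.
set pi := projC S C U in PE piA pipi subC idC.
have EC : (E <= C)%MS.
  by apply/row_subP => i; rewrite rowK (submx_trans (row_sub _ _)).
have EP : E *m P = 1%:M.
  by apply: (row_free_inj Efree); rewrite -mulmxA PE idC // mul1mx.
set A := (mxR R F)^T in piA.
have AF : A = map_mx intr F^T by rewrite /A map_trmx.
(* The rows of [E] form a basis of [C] and [P] reads off coordinates in it, so [B] is the matrix of
   [F] on [C]. *)
pose B := E *m A *m P; pose f := char_poly B.
have EA : E *m A = B *m E.
  by rewrite /B -mulmxA PE -mulmxA piA mulmxA idC.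
have fE : E *m horner_mx A f = 0.
  by rewrite (horner_mx_intertwine _ EA) Cayley_Hamilton mul0mx.
have fpi : horner_mx A f *m pi = 0.
  by rewrite -(horner_mx_intertwine _ (esym piA)) -PE -mulmxA fE mulmx0.
have fmonic : f \is monic := char_poly_monic B.
have eig l : root (map_poly (real_complex R) f) l -> complex_eigenvalue_on A C l.
  rewrite map_char_poly -eigenvalue_root_char => /eigenvalueP[w wB w0].
  exists (w *m map_mx (real_complex R) E); split.
  - by rewrite mulmx_sub // map_submx.
  - apply: contra w0 => /eqP.
    rewrite -[X in _ = X](mul0mx _ (map_mx (real_complex R) E)).
    by move=> /row_free_inj ->; rewrite // /row_free mxrank_map.
  - by rewrite -mulmxA -map_mxM EA map_mxM mulmxA wB scalemxAl.
(* For [v] in the left kernel, multiplying by [pi] gives [v pi = 0], so [f(A)] kills [v] and [v]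
   lies in [C], where [pi] is the identity. *)
have Munit : horner_mx A f + pi \in unitmx.
  rewrite -row_free_unit -kermx_eq0; apply: contraT => /rowV0Pn[v /sub_kermxP vM v0].
  have vpi : v *m pi = 0.
    by rewrite -(mul0mx _ pi) -vM -mulmxA mulmxDl fpi add0r pipi.
  have vf : v *m horner_mx A f = 0 by rewrite -vM mulmxDr vpi addr0.
  have vC := kernel_horner_center ph (monic_neq0 fmonic) eig vf.
  by rewrite -(idC _ v vC) vpi eqxx in v0.
have dual p := dual_katznelson_irreducible (p := p) ph irr.
have [k k0 kat] : exists2 K : R, 0 < K & forall p : 'cV[int]_d.+1, p != 0 ->
    K <= mxl1 (map_mx intr p - pi *m map_mx intr p) *
         mxl1 (map_mx intr p : 'cV[R]_d.+1) ^+ c.+1.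
  apply: (katznelson_lemma (f := f) (A0 := F^T)); rewrite -?AF //.
  exact: size_char_poly.
pose n : R := d.+1%:R; pose a := mxl1 (1%:M - pi).
pose L := mxl1 P * c.+1%:R + n; pose m := mxl1 E.
have n0 : 0 < n by rewrite ltr0n.
have a0 : 0 <= a := mxl1_ge0 _.
have m0 : 0 <= m := mxl1_ge0 _.
have L0 : 0 < L by rewrite ltr_wpDl // mulr_ge0 // mxl1_ge0.
pose X := a * n * L ^+ c.+1.
have X0 : 0 <= X by rewrite !mulr_ge0 ?exprn_ge0 // ltW.
have mn0 : 0 <= m * n by rewrite mulr_ge0 // ltW.
(* From [den * K < 1] follow [X * K < k], which contradicts Katznelson's lemma when [x] is nonzero,
   and [m * n * K < 1], which excludes [x = 0]. *)
pose den := (1 + k^-1 * X + m * n).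
have kX0 : 0 <= k^-1 * X by rewrite mulr_ge0 // invr_ge0 ltW.
have den0 : 0 < den by rewrite /den; lra.
pose K := (den + 1)^-1.
have K0 : 0 < K by rewrite invr_gt0; lra.
have Kden : den * K < 1 by rewrite ltr_pdivrMr; lra.
have K1 : K <= 1 by rewrite invf_le1; lra.
exists K; split=> // q q0.
set T := normZ R q; have T1 : 1 <= T by apply: normZ_ge1.
have Tc1 : 1 <= T ^+ c.+1 by rewrite exprn_ege1.
(* If [q] fails for every [i], the integers close to the entries of [P q] form an integer column [x]
   with small error [e]. *)
apply: contrapT => nex.
have /fin_all_exists[p hp] : forall i : 'I_d.+1, exists p : int,
    `|dotPq P i q - p%:~R| <= K / T ^+ c.+1.
  move=> i; apply: contrapT => h; apply: nex; exists i => p.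
  by rewrite ltNge; apply/negP => hp; apply: h; exists p.
pose x : 'cV[int]_d.+1 := \col_i p i.
pose qR : 'cV[R]_c.+1 := (map_mx intr q)^T.
pose e : 'cV[R]_d.+1 := map_mx intr x - P *m qR.
have ee : mxl1 e <= n * (K / T ^+ c.+1).
  apply: mxl1_col_le => i; rewrite !mxE distrC; apply: le_trans (hp i).
  rewrite /dotPq (eq_bigr (fun j => P i j * (q 0 j)%:~R)) // => j _.
  by rewrite !mxE.
have KT : K / T ^+ c.+1 <= K.
  by rewrite ler_pdivrMr ?ler_peMr // ?ltW //; lra.
have qle : mxl1 qR <= c.+1%:R * T.
  apply: le_trans (mxl1_le_normZ q).
  by rewrite /mxl1 exchange_big; apply: ler_sum => i _; apply: ler_sum => j _; rewrite !mxE.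
have xE : map_mx intr x = e + P *m qR by rewrite subrK.
have qE : qR = E *m map_mx intr x - E *m e.
  by rewrite xE mulmxDr [E *m (P *m _)]mulmxA EP mul1mx addrAC subrr add0r.
(* If [x = 0], then [q = - E e] is an integer vector of norm less than 1, hence 0. *)
have [x0|x0] := eqVneq x 0.
  move: qE; rewrite x0 map_mx0 mulmx0 sub0r => qE.
  suff : q^T = 0 by move=> h; move: q0; rewrite -(trmxK q) h trmx0 eqxx.
  apply: (@mxl1_int_lt1 R); rewrite -map_trmx -/qR qE -scaleN1r mxl1Z normrN1 mul1r.
  apply: le_lt_trans (mxl1M _ _) _; rewrite -/m.
  apply: (@le_lt_trans _ _ (m * n * K)).
    rewrite -mulrA ler_wpM2l //; apply: le_trans ee _.
    by rewrite ler_pM2l.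
  apply: le_lt_trans Kden; rewrite ler_pM2r // /den; lra.
have piP : pi *m P = P by rewrite -PE -mulmxA EP mulmx1.
(* [P q] lies in the range of [pi], so only the error survives. *)
have yE : map_mx intr x - pi *m map_mx intr x = (1%:M - pi) *m e.
  by rewrite xE mulmxBl mul1mx !mulmxDr mulmxA piP opprD addrACA subrr addr0.
have xle : mxl1 (map_mx intr x : 'cV[R]_d.+1) <= L * T.
  rewrite xE; apply: le_trans (mxl1D _ _) _; rewrite /L mulrDl addrC lerD //.
    rewrite -mulrA; apply: le_trans (mxl1M _ _) _.
    by rewrite ler_wpM2l // mxl1_ge0.
  apply: le_trans ee _; rewrite ler_pM2l //.
  by apply: le_trans KT _; lra.
have := kat x x0; rewrite yE leNgt; case/negP.
apply: (@le_lt_trans _ _ (a * (n * (K / T ^+ c.+1)) * (L * T) ^+ c.+1)).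
  apply: ler_pM; rewrite ?exprn_ge0 ?mxl1_ge0 //.
    by apply: le_trans (mxl1M _ _) _; rewrite ler_wpM2l.
  by rewrite lerXn2r // nnegrE ?mxl1_ge0 // mulr_ge0 //; lra.
(* The powers of [T] cancel: this is where the exponent [c] of the theorem comes from. *)
have -> : a * (n * (K / T ^+ c.+1)) * (L * T) ^+ c.+1 = X * K.
  rewrite exprMn /X; field; apply/expf_neq0; rewrite gt_eqF //; lra.
rewrite -[ltRHS]mulr1 -(ltr_pM2l (_ : 0 < k^-1)) ?invr_gt0 // mulKf ?gt_eqF //.
by rewrite mulrA; apply: le_lt_trans Kden; rewrite ler_pM2r // /den; lra.
Qed.
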